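(* Let $A_1,\ldots,A_8$ be the vertices of an octagon in $\mathbb P^2$ and let $\ell_{ij}$ be the line $A_iA_j$. Set $P_1=\ell_{18}\cap\ell_{23}$ and $P_2=\ell_{12}\cap\ell_{34}$, and let $\gamma_1$ and $\gamma_2$ be the conics through $A_1,A_2,A_5,A_6,P_1$ and through $A_2,A_3,A_6,A_7,P_2$, respectively. Write the four points of intersection of $\gamma_1$ and $\gamma_2$ as $\gamma_1\cap\gamma_2=\{A_2,A_6,B_1,B_2\}$. If the octagon is circumscribed to an irreducible conic $\gamma$, then the points $A_4,A_8,B_1,B_2$ are on a line.
   Context: Work over $\mathbb C$. The sides of the octagon are the eight lines $\ell_{12},\ell_{23},\ell_{34},\ell_{45},\ell_{56},\ell_{67},\ell_{78},\ell_{18}$. The octagon is circumscribed to $\gamma$ if these eight sides are distinct lines tangent to $\gamma$. *)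

(* Defs.v *)
From HB Require Import structures.
From mathcomp Require Import all_boot all_order all_algebra.
From mathcomp Require Import complex mpoly.
From mathcomp Require Import reals.

Set Implicit Arguments.
Unset Strict Implicit.
Unset Printing Implicit Defensive.

Import GRing.Theory.
Local Open Scope ring_scope.

(* Points of P^2(K) are the lines through 0 in K^3 and lines of P^2(K) are the
   planes through 0, so that Leibniz equality is equality of points (lines),
   [(U + V)%VS] is the join and [(U :&: V)%VS] the intersection. *)
Record point (K : fieldType) := Point {
  point_space :> {vspace 'rV[K]_3};
  _ : \dim point_space == 1%N }.

HB.instance Definition _ (K : fieldType) := [isSub for @point_space K].
HB.instance Definition _ (K : fieldType) := [Choice of point K by <:].

Section ProjectivePlane.
Variable K : fieldType.
Implicit Types (p q : point K) (l : {vspace 'rV[K]_3}) (F G : {mpoly K[3]}).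

Definition is_line l : Prop := \dim l = 2%N.

Definition line p q : {vspace 'rV[K]_3} := (p + q)%VS.

Definition collinear (s : seq (point K)) : Prop :=
  exists l, is_line l /\ forall p, p \in s -> (p <= l)%VS.

(* Homogeneous coordinates of p: [vpick p] is a nonzero vector spanning p.
   The notions below do not depend on this choice. *)
Definition coords p : 'I_3 -> K := vpick p ord0.

(* A conic is given by a nonzero ternary quadratic form, up to a scalar. *)
Definition conic F : Prop := F != 0 /\ F \is 2.-homog.

Definition on_curve F p : Prop := F.@[coords p] = 0.

Definition irreducible_curve F : Prop :=
  F \isn't a GRing.unit /\
  forall G H : {mpoly K[3]}, F = G * H ->
    G \is a GRing.unit \/ H \is a GRing.unit.

(* At a singular point p of F the second condition describes the whole plane,
   which is not a line. *)
Definition tangent F l : Prop :=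
  is_line l /\
  exists p, on_curve F p /\
    forall v : 'rV[K]_3,
      v \in l <-> \sum_i (F^`M(i)).@[coords p] * v ord0 i = 0.

Definition circumscribed (sides : seq {vspace 'rV[K]_3}) F : Prop :=
  uniq sides /\ forall l, l \in sides -> tangent F l.

(* For the local ring O of affine 3-space at p, h belongs to the ideal
   (F, G, L - 1) O. *)
Definition in_local_ideal F G (L : {mpoly K[3]}) p (h : {mpoly K[3]}) : Prop :=
  exists u a b c : {mpoly K[3]},
    u.@[coords p] != 0 /\ u * h = a * F + b * G + c * (L - 1).

(* The intersection multiplicity of F and G at p is m, that is, the local ring
   of P^2 at p modulo (F, G) has dimension m over K. This local ring is computed
   in the affine chart L = 1, where L is a linear form that is 1 at [coords p],
   so the quotient is O / (F, G, L - 1) with O as above. It is enough to test a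
   basis on polynomials: elements of K[x, y, z] that do not vanish at [coords p]
   act injectively on K[x, y, z] / ((F, G, L - 1) O :&: K[x, y, z]), hence
   bijectively if this is finite-dimensional. The multiplicity is 0 exactly when
   p is not on both curves, and no m fits when p is on a common component. *)
Definition intersection_multiplicity F G p (m : nat) : Prop :=
  exists L : {mpoly K[3]},
    [/\ L \is 1.-homog, L.@[coords p] = 1 &
        exists e : 'I_m -> {mpoly K[3]}, forall h : {mpoly K[3]},
          exists! c : 'rV[K]_m,
            in_local_ideal F G L p (h - \sum_i c ord0 i *: e i)].

(* The curves F and G meet exactly in the points of s, each one being listed as
   many times as its intersection multiplicity. *)
Definition intersection_is F G (s : seq (point K)) : Prop :=
  forall p, intersection_multiplicity F G p (count_mem p s).

End ProjectivePlane.

(* Main.v *)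
(** Parametrize the tangents of gamma by P^1, so that a point of the plane is an
   unordered pair {s, t} of parameters, namely those of the two tangents through
   it. Let t_1 = oo, t_2, ..., t_8 be the parameters of the sides l12, ..., l18,
   so that A_i = {t_(i-1), t_i}. The conic gamma1 passes through {1,2}, {1,8},
   {2,8}, {4,5}, {5,6}, which determines it explicitly, and likewise gamma2. With
   the right normalization,
     (t_3 - t_7) gamma1 + (t_4 - t_8) gamma2
   is the product of the equations of the lines A4A8 and A2A6. A point common to
   gamma1 and gamma2 that is not on A4A8 is therefore on A2A6, hence is A2 or A6;
   as gamma1 is transversal to A2A6 there, it has intersection multiplicity one,
   so it is not one of the residual points B1, B2. *)
Require Import Defs.
From HB Require Import structures.
From mathcomp Require Import all_boot all_order all_algebra.
From mathcomp Require Import complex mpoly.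
From mathcomp Require Import reals.
From mathcomp Require Import ring.

Set Implicit Arguments.
Unset Strict Implicit.
Unset Printing Implicit Defensive.

Import GRing.Theory Num.Theory.
Local Open Scope ring_scope.

(** * Lines and conics in tangent parameters *)

(* In a frame where the conic is y^2 = 4xz, the tangent of parameter t is
   x - ty + t^2 z = 0, and z = 0 is the tangent of parameter oo. The tangents
   s and t meet at {s, t} := (st, s + t, 1), the tangents oo and t meet at
   {oo, t} := (t, 1, 0). *)
Definition tangent_form (K : fieldType) (t x y z : K) : K := x - t * y + t ^+ 2 * z.

(* The line through {s, t} and {s', t'}. *)
Definition chord_form (K : fieldType) (s t s' t' x y z : K) : K :=
  (s + t - (s' + t')) * x - (s * t - s' * t') * y
  + (s * t * (s' + t') - s' * t' * (s + t)) * z.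

(* The line through {oo, u} and {s, t}. *)
Definition chord_form_oo (K : fieldType) (u s t x y z : K) : K :=
  x - u * y + (u * (s + t) - s * t) * z.

(* The conic through {oo, u}, {oo, w}, {u, w}, {p, q} and {q, r}. Up to a
   factor it is the Bezoutian (f(s) g(t) - f(t) g(s)) / (s - t) of
   f = (s - u)(s - w) and g = (s - p)(s - q)(s - r), written in terms of st and
   s + t. *)
Definition pencil_conic (K : fieldType) (u w p q r x y z : K) : K :=
  (w - u) * (tangent_form u x y z * tangent_form w x y z)
  + (q - w) * (w - p) * (w - r) * (z * tangent_form u x y z)
  - (q - u) * (u - p) * (u - r) * (z * tangent_form w x y z).

(** With a(s) = s - t2 and h(s) = (s - t5)(s - t6), the Bezoutians of the two conics antisymmetrize
    (s - t8)(t - t4) a(s) h(t) and (s - t3)(t - t7) a(s) h(t). The weights t3 - t7 and t4 - t8 make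
    the sum of (s - t8)(t - t4) and (s - t3)(t - t7) symmetric in s and t, so it splits off from
    a(s) h(t) - a(t) h(s), which gives the line A2A6. The symmetric factor vanishes at {t3, t4} and
    {t7, t8}, so it is the line A4A8. *)
Lemma pencil_conic_eq (K : fieldType) (t2 t3 t4 t5 t6 t7 t8 x y z : K) :
  (t3 - t2) * (t3 - t7) * pencil_conic t2 t8 t4 t5 t6 x y z
  + (t8 - t2) * (t4 - t8) * pencil_conic t2 t3 t5 t6 t7 x y z
  = (t8 - t2) * (t3 - t2) *
    (chord_form t3 t4 t7 t8 x y z * chord_form_oo t2 t5 t6 x y z).
Proof. rewrite /pencil_conic /chord_form /chord_form_oo /tangent_form. ring. Qed.

(** The first three points are the vertices of the triangle formed by the tangents oo, u and w, so Q
    is a combination of the pairwise products of these tangents. The last two points fix the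
    coefficients up to a common factor. *)
Lemma pencil_conic_uniq (K : fieldType) (Q : K -> K -> K -> K)
    (a b c d e f u w p q r : K) :
  (forall x y z, Q x y z = a * x ^+ 2 + b * y ^+ 2 + c * z ^+ 2
                           + d * (x * y) + e * (x * z) + f * (y * z)) ->
  w != u -> q != u -> q != w -> r != p ->
  Q u 1 0 = 0 -> Q w 1 0 = 0 -> Q (u * w) (u + w) 1 = 0 ->
  Q (p * q) (p + q) 1 = 0 -> Q (q * r) (q + r) 1 = 0 ->
  exists k, forall x y z, Q x y z = k * pencil_conic u w p q r x y z.
Proof.
move=> QE; rewrite !QE -!(subr_eq0 w) -!(subr_eq0 q) -!(subr_eq0 r).
move=> wu0 qu0 qw0 rp0 Qu Qw Quw Qpq Qqr.
have dE : d = - a * (u + w).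
  apply: (mulfI wu0); apply/eqP; rewrite -subr_eq0; apply/eqP.
  transitivity ((a * w ^+ 2 + b * 1 ^+ 2 + c * 0 ^+ 2 + d * (w * 1) + e * (w * 0) + f * (1 * 0))
   - (a * u ^+ 2 + b * 1 ^+ 2 + c * 0 ^+ 2 + d * (u * 1) + e * (u * 0) + f * (1 * 0))); first by ring.
  by rewrite Qu Qw subrr.
have bE : b = a * u * w.
  apply/eqP; rewrite -subr_eq0; apply/eqP; rewrite -[RHS]Qu dE; ring.
(* [al] and [de] are the coefficients of z times the tangent u and of z times the tangent w; the
   product of the tangents u and w has coefficient [a]. *)
pose al := (w * (e - a * (u ^+ 2 + w ^+ 2)) + (f + a * (u * w ^+ 2 + w * u ^+ 2))) / (w - u).
pose de := e - a * (u ^+ 2 + w ^+ 2) - al.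
have eE : e = al + de + a * (u ^+ 2 + w ^+ 2) by rewrite /de; ring.
have fE : f = - al * u - de * w - a * (u * w ^+ 2 + w * u ^+ 2).
  rewrite /de /al; field; exact: wu0.
have cE : c = a * u ^+ 2 * w ^+ 2 + al * u ^+ 2 + de * w ^+ 2.
  apply/eqP; rewrite -subr_eq0; apply/eqP; rewrite -[RHS]Quw dE bE eE fE; ring.
rewrite {}bE {}cE {}dE {}fE {}eE in QE Qpq Qqr *.
(* The tangent form of u at {p, q} is (p - u)(q - u). Weighting the two conditions by r - w and p -
   w therefore cancels [de] and leaves the factor (r - p)(q - u). *)
have alE : al * (w - u) = a * ((q - w) * (w - p) * (w - r)).
  apply: (mulfI rp0); apply: (mulfI qu0); apply/eqP; rewrite -subr_eq0; apply/eqP.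
  have <- : (r - w) * 0 - (p - w) * 0 = 0 by rewrite !mulr0 subrr.
  by rewrite -{1}Qpq -Qqr; ring.
have deE : de * (w - u) = - a * ((q - u) * (u - p) * (u - r)).
  apply: (mulfI rp0); apply: (mulfI qw0); apply/eqP; rewrite -subr_eq0; apply/eqP.
  have <- : (p - u) * 0 - (r - u) * 0 = 0 by rewrite !mulr0 subrr.
  by rewrite -{1}Qqr -Qpq; ring.
exists (a / (w - u)) => x y z; rewrite QE /pencil_conic /tangent_form.
have -> : al = a * ((q - w) * (w - p) * (w - r)) / (w - u) by rewrite -alE mulfK.
have -> : de = - a * ((q - u) * (u - p) * (u - r)) / (w - u) by rewrite -deE mulfK.
by field.
Qed.

(** * Linear and quadratic forms, polarization and frames *)

Lemma homog_ind (n d : nat) (K : fieldType) (P : {mpoly K[n]} -> Prop) :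
  P 0 -> (forall F G, P F -> P G -> P (F + G)) ->
  (forall c m, mdeg m = d -> P (c *: 'X_[m])) ->
  forall F, F \is d.-homog -> P F.
Proof.
move=> P0 PD PX F /dhomogP hF; rewrite [F]mpolyE big_seq.
by apply: big_ind => // m mF; apply: PX; exact: hF.
Qed.

Section Forms.
Variable K : numFieldType.
Implicit Types (F G L : {mpoly K[3]}) (u v w : 'rV[K]_3).

Definition linear_form (a : 'I_3 -> K) : {mpoly K[3]} := \sum_i a i *: 'X_i.

Definition quadratic_form (S : 'M[K]_3) : {mpoly K[3]} :=
  \sum_i \sum_j S i j *: ('X_i * 'X_j).

Lemma linear_formP L : L \is 1.-homog -> exists a, L = linear_form a.
Proof.
move: L; apply: homog_ind => [|F G [a ->] [b ->]|c m /eqP/mdeg1P[i /eqP ->]].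
- by exists (fun=> 0); rewrite /linear_form big1 // => i _; rewrite scale0r.
- exists (fun i => a i + b i); rewrite -big_split /=.
  by apply: eq_bigr => i _; rewrite scalerDl.
- exists (fun j => if j == i then c else 0).
  rewrite /linear_form (bigD1 i) //= eqxx big1 ?addr0 // => j /negPf ->.
  by rewrite scale0r.
Qed.

Lemma quadratic_formP F : F \is 2.-homog -> exists S, F = quadratic_form S.
Proof.
move: F; apply: homog_ind => [|F G [a ->] [b ->]|c m].
- exists 0; rewrite /quadratic_form big1 // => i _.
  by rewrite big1 // => j _; rewrite mxE scale0r.
- exists (a + b); rewrite -big_split /=.
  apply: eq_bigr => i _; rewrite -big_split /=; apply: eq_bigr => j _.
  by rewrite mxE scalerDl.
- move=> m2; have [i mi] : exists i, m i != 0%N.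
    apply/existsP; apply: contra_eqT m2; rewrite negb_exists => /forallP m0.
    rewrite mdegE big1 // => i _; apply/eqP; have := m0 i; by rewrite negbK.
  have mE : m = (U_(i) + (m - U_(i)))%MM by rewrite addmC submK // lep1mP.
  have /mdeg1P[j /eqP jE] : mdeg (m - U_(i)) == 1%N.
    by rewrite mE mdegD mdeg1 add1n in m2; case: m2 => ->.
  exists (c *: delta_mx i j).
  rewrite /quadratic_form (bigD1 i) //= [X in _ + X]big1 ?addr0; last first.
    by move=> k /negPf ki; rewrite big1 // => l _; rewrite !mxE ki /= mulr0 scale0r.
  rewrite (bigD1 j) //= big1 ?addr0; last first.
    by move=> k /negPf ki; rewrite !mxE ki andbF mulr0 scale0r.
  by rewrite !mxE !eqxx mulr1 mE jE mpolyXD.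
Qed.

Lemma linear_form_eval a v : (linear_form a).@[v ord0] = \sum_i a i * v ord0 i.
Proof.
by rewrite raddf_sum; apply: eq_bigr => i _; rewrite /= mevalZ mevalXU.
Qed.

Lemma quadratic_form_eval S v :
  (quadratic_form S).@[v ord0] = \sum_i \sum_j S i j * (v ord0 i * v ord0 j).
Proof.
rewrite raddf_sum; apply: eq_bigr => i _ /=; rewrite raddf_sum.
by apply: eq_bigr => j _; rewrite /= mevalZ mevalM !mevalXU.
Qed.

Lemma quadratic_form_polar S u v :
  \sum_i ((quadratic_form S)^`M(i)).@[u ord0] * v ord0 i =
  \sum_i \sum_j S i j * (u ord0 i * v ord0 j + v ord0 i * u ord0 j).
Proof.
have dX (i k : 'I_3) : ('X_k : {mpoly K[3]})^`M(i) = (k == i)%:R.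
  rewrite mderivX mnm1E; case: eqP => [->|_]; last by rewrite scale0r.
  rewrite scale1r -[X in (X - _)%MM]add0m addmK mpolyX0.
  by [].
have dE i : ((quadratic_form S)^`M(i)).@[u ord0] =
    \sum_k \sum_l S k l * ((k == i)%:R * u ord0 l + u ord0 k * (l == i)%:R).
  rewrite /quadratic_form (raddf_sum (mderiv i)) (raddf_sum (meval _)); apply: eq_bigr => k _ /=.
  rewrite (raddf_sum (mderiv i)) (raddf_sum (meval _)); apply: eq_bigr => l _ /=.
  rewrite mderivZ mderivM !dX mevalZ mevalD !mevalM !mevalXU.
  by rewrite !(rmorph_nat (meval _)).
under eq_bigr do rewrite dE.
by rewrite !big_ord_recl !big_ord0 /=; ring.
Qed.

Lemma linear_form_homog a : linear_form a \is 1.-homog.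
Proof.
by apply: rpred_sum => i _; rewrite rpredZ // dhomogX /= mdeg1.
Qed.

Lemma evalD1 L : L \is 1.-homog -> forall x y z (e1 e2 e3 : 'rV[K]_3),
  L.@[(x *: e1 + y *: e2 + z *: e3) ord0] =
  x * L.@[e1 ord0] + y * L.@[e2 ord0] + z * L.@[e3 ord0].
Proof.
move=> /linear_formP[a ->] x y z e1 e2 e3.
by rewrite !linear_form_eval !big_ord_recl !big_ord0 !mxE; ring.
Qed.

(** For a quadratic form F this is its symmetric bilinear form, with value 2 F(v) on the diagonal.
    Written with derivatives, it is literally the left side of the equation in [tangent]. *)
Definition polar F u v : K := \sum_i (F^`M(i)).@[u ord0] * v ord0 i.

Lemma polarDr F u x y z (e1 e2 e3 : 'rV[K]_3) :
  polar F u (x *: e1 + y *: e2 + z *: e3) =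
  x * polar F u e1 + y * polar F u e2 + z * polar F u e3.
Proof. by rewrite /polar !big_ord_recl !big_ord0 !mxE; ring. Qed.

Section Quadratic.
Variable F : {mpoly K[3]}.
Hypothesis F2 : F \is 2.-homog.

Lemma polarC u v : polar F u v = polar F v u.
Proof.
have [S ->] := quadratic_formP F2; rewrite /polar !quadratic_form_polar.
by rewrite !big_ord_recl !big_ord0; ring.
Qed.

Lemma evalD2 x y z (e1 e2 e3 : 'rV[K]_3) :
  F.@[(x *: e1 + y *: e2 + z *: e3) ord0] =
  F.@[e1 ord0] * x ^+ 2 + F.@[e2 ord0] * y ^+ 2 + F.@[e3 ord0] * z ^+ 2
  + polar F e1 e2 * (x * y) + polar F e1 e3 * (x * z) + polar F e2 e3 * (y * z).
Proof.
have [S ->] := quadratic_formP F2; rewrite /polar !quadratic_form_polar.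
rewrite !quadratic_form_eval !big_ord_recl !big_ord0 !mxE; ring.
Qed.

Lemma eval2Z a v : F.@[(a *: v) ord0] = a ^+ 2 * F.@[v ord0].
Proof.
have := evalD2 a 0 0 v 0 0; rewrite !scale0r !addr0 => ->.
by rewrite !mulr0 expr0n /= !mulr0 !addr0 mulrC.
Qed.

Lemma polarvv v : polar F v v = 2 * F.@[v ord0].
Proof.
have [S ->] := quadratic_formP F2; rewrite /polar !quadratic_form_polar.
rewrite !quadratic_form_eval !big_ord_recl !big_ord0; ring.
Qed.

(** Polarizing at pairs of basis vectors gives [S i j + S j i = 0]. Summed over all pairs this is
    [F *+ 2 = 0], and 2 is invertible. *)
Lemma quadratic_eq0 : (forall v, F.@[v ord0] = 0) -> F = 0.
Proof.
have [S FE] := quadratic_formP F2; move=> F0.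
have sum_delta (f : 'I_3 -> K) (i : 'I_3) : \sum_k f k * (k == i)%:R = f i.
  rewrite (bigD1 i) //= eqxx mulr1 big1 ?addr0 // => k /negPf ->.
  by rewrite mulr0.
have S0 i j : S i j + S j i = 0.
  have := quadratic_form_polar S (delta_mx 0 i) (delta_mx 0 j).
  rewrite -FE -/(polar _ _ _).
  have -> : polar F (delta_mx 0 i) (delta_mx 0 j) = 0.
    have := evalD2 1 1 0 (delta_mx 0 i) (delta_mx 0 j) 0.
    by rewrite !F0 !mul0r !mulr0 !mulr1 !addr0 !add0r => <-.
  move=> ->; under eq_bigr => k _.
    under eq_bigr do rewrite !mxE /= mulrDr !mulrA.
    rewrite big_split /= sum_delta sum_delta.
    over.
  by rewrite big_split /= !sum_delta.
have : F *+ 2 = 0.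
  rewrite mulr2n FE {2}/quadratic_form exchange_big /= -big_split /=.
  apply: big1 => i _; rewrite -big_split /=; apply: big1 => j _.
  by rewrite ['X_j * _]mulrC -scalerDl S0 scale0r.
rewrite -scaler_nat => /eqP; rewrite scaler_eq0 pnatr_eq0 /= => /eqP; exact.
Qed.
End Quadratic.

Lemma quadratic_ext F G : F \is 2.-homog -> G \is 2.-homog ->
  (forall v, F.@[v ord0] = G.@[v ord0]) -> F = G.
Proof.
move=> F2 G2 FG; apply/eqP; rewrite -subr_eq0; apply/eqP.
apply: quadratic_eq0 => [|v]; first by rewrite rpredB.
by rewrite mevalB FG subrr.
Qed.

Lemma linear_ext L L' : L \is 1.-homog -> L' \is 1.-homog ->
  (forall v, L.@[v ord0] = L'.@[v ord0]) -> L = L'.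
Proof.
move=> /linear_formP[a ->] /linear_formP[b ->] ab.
apply: eq_bigr => i _; congr (_ *: _).
have := ab (delta_mx 0 i); rewrite !linear_form_eval.
have sum_delta (f : 'I_3 -> K) : \sum_k f k * (delta_mx 0 i : 'rV_3) ord0 k = f i.
  rewrite (bigD1 i) //= big1 => [|k /negPf ki]; rewrite !mxE ?ki ?mulr0 //.
  by rewrite !eqxx mulr1 addr0.
by rewrite !sum_delta.
Qed.

Definition frame (e1 e2 e3 : 'rV[K]_3) : Prop :=
  forall x y z, x *: e1 + y *: e2 + z *: e3 = 0 -> [/\ x = 0, y = 0 & z = 0].

Lemma frame_coords e1 e2 e3 : frame e1 e2 e3 ->
  exists X Y Z : {mpoly K[3]},
    [/\ X \is 1.-homog, Y \is 1.-homog & Z \is 1.-homog] /\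
    forall v, v = X.@[v ord0] *: e1 + Y.@[v ord0] *: e2 + Z.@[v ord0] *: e3.
Proof.
move=> fr; pose E := \matrix_(i < 3) nth 0 [:: e1; e2; e3] i.
have mulE (v : 'rV_3) : v *m E = v ord0 0 *: e1 + v ord0 1 *: e2 + v ord0 2%:R *: e3.
  rewrite mulmx_sum_row !big_ord_recl big_ord0 !rowK /= addr0 addrA.
  by congr (_ *: _ + _ *: _ + _ *: _); congr (v _ _); apply: val_inj.
have Eu : E \in unitmx.
  rewrite -row_free_unit; apply: inj_row_free => v; rewrite mulE => /fr[v0 v1 v2].
  apply/rowP => i; rewrite mxE.
  case: i => [[|[|[|//]]] ilt];
    [rewrite -v0|rewrite -v1|rewrite -v2]; congr (v _ _); exact: val_inj.
pose X k := linear_form (fun i => invmx E i k).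
exists (X 0), (X 1), (X 2%:R); split; first by split; apply: linear_form_homog.
have XE k (v : 'rV_3) : (X k).@[v ord0] = (v *m invmx E) ord0 k.
  by rewrite linear_form_eval mxE; apply: eq_bigr => i _; rewrite mulrC.
by move=> v; rewrite !XE -mulE mulmxKV.
Qed.

Lemma frame_inj e1 e2 e3 x y z x' y' z' : frame e1 e2 e3 ->
  x *: e1 + y *: e2 + z *: e3 = x' *: e1 + y' *: e2 + z' *: e3 ->
  [/\ x = x', y = y' & z = z'].
Proof.
move=> fr /eqP; rewrite -subr_eq0 => /eqP E.
have [|/subr0_eq ? /subr0_eq ? /subr0_eq ?//] := fr (x - x') (y - y') (z - z').
by rewrite -[RHS]E; apply/rowP => i; rewrite !mxE; ring.
Qed.
End Forms.

(** * The local ideal of two curves at a point *)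

Section LocalIdeal.
Variables (K : fieldType) (F G L : {mpoly K[3]}) (p : point K).
Local Notation I := (in_local_ideal F G L p).

Lemma local_idealD g h : I g -> I h -> I (g + h).
Proof.
move=> [u [a [b [c [u0 ug]]]]] [u' [a' [b' [c' [u'0 uh]]]]].
exists (u * u'), (u' * a + u * a'), (u' * b + u * b'), (u' * c + u * c').
split; first by rewrite mevalM mulf_neq0.
rewrite mulrDr [X in X * g]mulrC -!mulrA ug uh; ring.
Qed.

Lemma local_idealMl g h : I h -> I (g * h).
Proof.
move=> [u [a [b [c [u0 uh]]]]]; exists u, (g * a), (g * b), (g * c).
by split=> //; rewrite mulrCA uh; ring.
Qed.

Lemma local_idealZ (k : K) h : I h -> I (k *: h).
Proof. by rewrite -mul_mpolyC; apply: local_idealMl. Qed.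

Lemma local_ideal_unit g h : g.@[coords p] != 0 -> I (g * h) -> I h.
Proof.
move=> g0 [u [a [b [c [u0 uh]]]]]; exists (u * g), a, b, c.
by rewrite mevalM mulf_neq0 // -mulrA.
Qed.

Lemma local_idealF : I F.
Proof. by exists 1, 1, 0, 0; rewrite meval1 oner_neq0; split=> //; ring. Qed.
Lemma local_idealG : I G.
Proof. by exists 1, 0, 1, 0; rewrite meval1 oner_neq0; split=> //; ring. Qed.
Lemma local_idealL : I (L - 1).
Proof. by exists 1, 0, 0, 1; rewrite meval1 oner_neq0; split=> //; ring. Qed.
Lemma local_ideal0 : I 0.
Proof. by exists 1, 0, 0, 0; rewrite meval1 oner_neq0; split=> //; ring. Qed.

(** The polynomials congruent to their value at p form a subring that contains the constants and, by
    hypothesis, the variables. So the local quotient is spanned by 1. *)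
Lemma local_ideal_coords : (forall i, I ('X_i - (coords p i)%:MP)) ->
  forall h, I (h - (h.@[coords p])%:MP).
Proof.
move=> Ix h.
pose P h := I (h - (h.@[coords p])%:MP).
have PC c : P c%:MP by rewrite /P mevalC subrr; exact: local_ideal0.
have PD g k : P g -> P k -> P (g + k).
  rewrite /P => Ig Ik; rewrite mevalD mpolyCD.
  by rewrite opprD addrACA; apply: local_idealD.
have PM g k : P g -> P k -> P (g * k).
  rewrite /P => Ig Ik; rewrite mevalM mpolyCM.
  have -> : forall a b : {mpoly K[3]}, g * k - a * b = k * (g - a) + a * (k - b).
    by move=> a b; ring.
  by apply: local_idealD; apply: local_idealMl.
elim/mpolyind: h => [|c m q _ _ Pq]; first by rewrite -mpolyC0; apply: PC.
apply: PD Pq; rewrite -mul_mpolyC; apply: (PM _ _ (PC c)).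
rewrite mpolyXE_id; apply: (big_ind P (PC 1) PM) => i _.
elim: (m i) => [|n Pn]; first exact: (PC 1).
rewrite exprS; apply: PM => //; rewrite /P mevalXU; exact: Ix.
Qed.

End LocalIdeal.

(** * Bounds on intersection multiplicities *)

Section Multiplicity.
Variables (K : fieldType) (F G : {mpoly K[3]}) (p : point K).

(** A curve that misses p is a unit at p, so the local ideal is everything. Then every coefficient
    vector represents 0, against uniqueness when m is positive. *)
Lemma multiplicity_on_curve m : (0 < m)%N -> intersection_multiplicity F G p m ->
  on_curve F p /\ on_curve G p.
Proof.
case: m => // m _ [L [_ Lp [e He]]].
have [//|Ix] : (on_curve F p /\ on_curve G p) \/ forall h, in_local_ideal F G L p h.
  have [Fp|Fp] := eqVneq F.@[coords p] 0; last first.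
    right=> h; apply: (local_ideal_unit Fp).
    by rewrite mulrC; apply/local_idealMl/local_idealF.
  have [Gp|Gp] := eqVneq G.@[coords p] 0; first by left.
  right=> h; apply: (local_ideal_unit Gp).
  by rewrite mulrC; apply/local_idealMl/local_idealG.
have [c [_ cU]] := He 0.
have := cU 0 (Ix _); rewrite (cU (const_mx 1) (Ix _)).
by move/rowP/(_ ord0); rewrite !mxE => /eqP; rewrite oner_eq0.
Qed.

Lemma multiplicity0 : intersection_multiplicity F G p 0 ->
  on_curve F p -> on_curve G p -> False.
Proof.
move=> [L [_ Lp [e He]]] Fp Gp.
have [c [[u [a [b [d [u0 uE]]]]] _]] := He 1.
case/eqP: u0; move: uE; rewrite big_ord0 subr0 mulr1 => ->.
by rewrite !mevalD !mevalM mevalB meval1 Lp Fp Gp subrr !mulr0 !addr0.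
Qed.

(** The quotient is spanned by 1, so it has no two independent elements. The hypothesis ranges over
    all [L] because the chart is hidden in the multiplicity. *)
Lemma multiplicity_le1 m :
  (forall L, L \is 1.-homog -> L.@[coords p] = 1 ->
     forall i, in_local_ideal F G L p ('X_i - (coords p i)%:MP)) ->
  intersection_multiplicity F G p m -> (m <= 1)%N.
Proof.
move=> simple [L [L1 Lp [e He]]].
have Ih := local_ideal_coords (simple L L1 Lp).
case: m e He => [|[|m]] // e He; exfalso.
pose i0 : 'I_m.+2 := ord0; pose i1 : 'I_m.+2 := lift ord0 ord0.
have sumE (c : 'rV[K]_m.+2) a b : c = a *: delta_mx 0 i0 + b *: delta_mx 0 i1 ->
    \sum_i c ord0 i *: e i = a *: e i0 + b *: e i1.
  move=> ->; rewrite (bigD1 i0) //= (bigD1 i1) //= big1 ?addr0.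
    by rewrite !mxE !eqxx /= !mulr0 !mulr1 addr0 add0r.
  by move=> i /andP[/negPf h0 /negPf h1]; rewrite !mxE h0 h1 !mulr0 addr0 scale0r.
have [c [_ cU]] := He 0.
have indep a b : in_local_ideal F G L p (a *: e i0 + b *: e i1) -> a = 0 /\ b = 0.
  move=> Iab; have z0 : c = 0.
    by apply: cU; rewrite big1 ?subr0 => [|i _]; rewrite ?mxE ?scale0r //; exact: local_ideal0.
  have : c = a *: delta_mx 0 i0 + b *: delta_mx 0 i1.
    apply: cU; rewrite (sumE _ a b erefl) sub0r -scaleN1r; exact: local_idealZ.
  rewrite z0 => /rowP r; move: (r i0) (r i1).
  by rewrite !mxE !eqxx /= !mulr0 !mulr1 addr0 add0r.
(* Each basis element is congruent to its value at p, so the two are related by their swapped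
   values. Independence makes both values zero, which puts [e i0] itself in the ideal. *)
have [b0 a0] : (e i1).@[coords p] = 0 /\ - (e i0).@[coords p] = 0.
  apply: indep; set a := (e i0).@[_]; set b := (e i1).@[_].
  have -> : b *: e i0 + - a *: e i1 =
    b *: (e i0 - a%:MP) + - a *: (e i1 - b%:MP).
    by rewrite -!mul_mpolyC mpolyCN; ring.
  by apply: local_idealD; apply: local_idealZ; exact: Ih.
have [] : (1 : K) = 0 /\ (0 : K) = 0.
  apply: indep; rewrite scale1r scale0r addr0.
  have e0 : (e i0).@[coords p] = 0 by apply/eqP; rewrite -oppr_eq0 a0.
  by move: (Ih (e i0)); rewrite e0 mpolyC0 subr0.
by move/eqP; rewrite oner_eq0.
Qed.

End Multiplicity.

Section SimplePoint.
Variable K : numFieldType.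

(* Since M is a unit at p, the local ideal (F, G) equals (F, N), and the line N
   meets F in the distinct points p and w, hence transversally at p. *)
Lemma transversal_multiplicity (F G M N : {mpoly K[3]}) (a b : K)
    (p : point K) (w n : 'rV[K]_3) m :
  F \is 2.-homog -> N \is 1.-homog -> a *: F + b *: G = M * N ->
  frame (vpick p) w n -> N.@[n ord0] != 0 -> N.@[coords p] = 0 -> N.@[w ord0] = 0 ->
  on_curve F p -> F.@[w ord0] = 0 -> polar F (vpick p) w != 0 ->
  M.@[coords p] != 0 ->
  intersection_multiplicity F G p m -> (m <= 1)%N.
Proof.
set v := vpick p => F2 N1 FG fr Nn Nv Nw Fv Fw vw0 Mv.
rewrite /on_curve /coords -/v in Fv Nv Mv.
have [X [Y [Z [[X1 Y1 Z1] XYZ]]]] := frame_coords fr.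
have vX : X.@[v ord0] = 1.
  suff [-> _ _] : [/\ X.@[v ord0] = 1, Y.@[v ord0] = 0 & Z.@[v ord0] = 0].
    by [].
  by apply: (frame_inj fr); rewrite -XYZ !scale0r !addr0 scale1r.
have linE T : T \is 1.-homog -> T = T.@[v ord0] *: X + T.@[w ord0] *: Y + T.@[n ord0] *: Z.
  move=> T1; apply: linear_ext => // [|u]; first by rewrite !rpredD ?rpredZ.
  by rewrite {1}[u]XYZ evalD1 // !mevalD !mevalZ; ring.
apply: multiplicity_le1 => L L1 Lp.
have IZ : in_local_ideal F G L p Z.
  have -> : Z = (N.@[n ord0])^-1 *: N.
    by rewrite [X in _ *: X]linE // Nv Nw !scale0r !add0r scalerA mulVf ?scale1r.
  apply: local_idealZ; apply: (local_ideal_unit Mv); rewrite -FG.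
  by apply: local_idealD; apply: local_idealZ; [exact: local_idealF | exact: local_idealG].
(* As F vanishes at v and w, only a multiple of X Y remains modulo Z. Since X is 1 at p, this puts Y
   in the ideal. *)
pose H := F.@[n ord0] *: Z + polar F v n *: X + polar F w n *: Y.
have FE : F = polar F v w *: (X * Y) + Z * H.
  apply: quadratic_ext => // [|u].
    rewrite rpredD ?rpredZ ?(dhomogM X1 Y1) //.
    by apply: (dhomogM Z1); rewrite !rpredD ?rpredZ.
  rewrite {1}[u]XYZ evalD2 // /v Fv Fw /H !(mevalD, mevalM, mevalZ); ring.
have IY : in_local_ideal F G L p Y.
  apply: (@local_ideal_unit _ _ _ _ _ X); first by rewrite /coords -/v vX oner_neq0.
  have -> : X * Y = (polar F v w)^-1 *: (F + (- H) * Z).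
    rewrite {2}FE mulNr [H * _]mulrC addrK scalerA mulVf ?scale1r //.
  apply/local_idealZ/local_idealD; [exact: local_idealF | exact: local_idealMl].
have IX : in_local_ideal F G L p (X - 1).
  have -> : X - 1 = (L - 1) + (- L.@[w ord0] *: Y + - L.@[n ord0] *: Z).
    rewrite {1}[L]linE // [L.@[v ord0]]Lp scale1r !scaleNr.
    by rewrite -!addrA; congr (_ + _); rewrite addrCA addrC -!addrA; ring.
  apply: local_idealD; first exact: local_idealL.
  by apply: local_idealD; apply: local_idealZ.
move=> i; have -> : 'X_i - (coords p i)%:MP =
    v ord0 i *: (X - 1) + (w ord0 i *: Y + n ord0 i *: Z).
  rewrite [X in X - _]linE ?dhomogX /= ?mdeg1 // !mevalXU -!mul_mpolyC /coords -/v.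
  by ring.
by do 2?[apply: local_idealD]; apply: local_idealZ.
Qed.

End SimplePoint.

(** * Normal form of a conic with respect to its tangents *)

Section TangentFrame.
Variables (K : numFieldType) (F : {mpoly K[3]}).
Hypothesis F2 : F \is 2.-homog.

Lemma polarDD x y z x' y' z' (e1 e2 e3 : 'rV[K]_3) :
  polar F (x *: e1 + y *: e2 + z *: e3) (x' *: e1 + y' *: e2 + z' *: e3) =
  2 * (F.@[e1 ord0] * (x * x') + F.@[e2 ord0] * (y * y') + F.@[e3 ord0] * (z * z'))
  + polar F e1 e2 * (x * y' + y * x') + polar F e1 e3 * (x * z' + z * x')
  + polar F e2 e3 * (y * z' + z * y').
Proof.
rewrite polarDr ![polar F (_ + _) _]polarC // !polarDr !polarvv //.
rewrite [polar F e2 e1]polarC // [polar F e3 e1]polarC // [polar F e3 e2]polarC //.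
ring.
Qed.

Lemma tangentP l : tangent F l ->
  [/\ \dim l = 2%N & exists2 r : 'rV[K]_3, F.@[r ord0] = 0 &
      forall v, v \in l <-> polar F r v = 0].
Proof. by move=> [l2 [p [Fp lE]]]; split=> //; exists (vpick p). Qed.

Lemma line_not_full (l : {vspace 'rV[K]_3}) : \dim l = 2%N -> ~ forall v, v \in l.
Proof.
move=> l2 lf; have lE : l = fullv by apply/vspaceP => v; rewrite lf memvf.
by have := dimvf ('rV[K]_3); rewrite /dim /= mul1n -lE l2.
Qed.

Lemma line_cap (l l' : {vspace 'rV[K]_3}) : \dim l = 2%N -> \dim l' = 2%N ->
  l != l' -> \dim (l :&: l') = 1%N.
Proof.
move=> d d' ll'; have := dimv_sum_cap l l'; rewrite d d'.
have := dimvS (subvf (l + l')); rewrite dimvf /dim /= mul1n => le3 sE.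
have : (\dim (l :&: l') < 2)%N; last first.
  by move: (\dim (l :&: l')) sE le3 => [|[|n]] //; rewrite addn0 => ->.
rewrite ltnNge; apply: contra ll' => ge2.
have /eqP <- : (l :&: l')%VS == l by rewrite eqEdim capvSl d.
by rewrite eqEdim capvSr d'.
Qed.

(** The frame is made of the contact point of [l1], the common point of [l1] and [l3], and a
    multiple of the contact point of [l3]. The contact points lie on F and are conjugate to the
    middle point, so only the terms in y^2 and x z survive. *)
Lemma tangent_frame l1 l3 l4 : tangent F l1 -> tangent F l3 -> tangent F l4 ->
  l1 != l3 -> l4 != l1 -> l4 != l3 ->
  exists e1 e2 e3 : 'rV[K]_3, [/\ frame e1 e2 e3,
    forall x y z, x *: e1 + y *: e2 + z *: e3 \in l1 <-> z = 0 &
    forall l, tangent F l -> l != l1 -> exists t, forall x y z,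
      x *: e1 + y *: e2 + z *: e3 \in l <-> tangent_form t x y z = 0].
Proof.
move=> /tangentP[d1 [u Fu l1E]] /tangentP[d3 [w Fw l3E]] T4 n13 n41 n43.
have n0 l r : \dim l = 2%N -> (forall v, v \in l <-> polar F r v = 0) -> r != 0.
  move=> d lE; apply/eqP => r0; apply: (line_not_full d) => v.
  by apply/lE; rewrite r0 polarC // /polar big1 // => i _; rewrite mxE mulr0.
have dV := line_cap d1 d3 n13; set V := (l1 :&: l3)%VS in dV.
have VE (v : 'rV_3) : v \in V -> v != 0 -> V = <[v]>%VS.
  move=> vV v0; apply/esym/eqP; rewrite eqEdim dim_vline v0 dV leqnn andbT.
  by rewrite -memvE.
(* Otherwise both contact points lie in the one-dimensional [V], so they are proportional and have
   the same polar line. *)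
have Buw : polar F u w != 0.
  apply: contra n13 => /eqP uw0.
  have uV : u \in V.
    by rewrite memv_cap; apply/andP; split; [apply/l1E; rewrite polarvv // Fu mulr0
      | apply/l3E; rewrite polarC].
  have wV : w \in V.
    by rewrite memv_cap; apply/andP; split; [apply/l1E
      | apply/l3E; rewrite polarvv // Fw mulr0].
  have u0 := n0 _ _ d1 l1E; have w0 := n0 _ _ d3 l3E.
  have /vlineP[k wE] : w \in <[u]>%VS by rewrite -VE.
  have k0 : k != 0 by apply: contraNneq w0 => k0; rewrite wE k0 scale0r.
  apply/eqP/vspaceP => v.
  have kE : polar F w v = k * polar F u v.
    rewrite polarC // [polar F u v]polarC // wE.
    by have := polarDr F v k 0 0 u 0 0; rewrite !scale0r !addr0 !mul0r !addr0.
  apply/idP/idP => [/l1E uv | /l3E]; first by apply/l3E; rewrite kE uv mulr0.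
  by rewrite kE => /eqP; rewrite mulf_eq0 (negPf k0) => /eqP uv; apply/l1E.
pose q := vpick V.
have q0 : q != 0 by rewrite vpick0 -dimv_eq0 dV.
have : q \in V by apply: memv_pick.
rewrite memv_cap => /andP[/l1E Buq /l3E Bwq].
have Bqw : polar F q w = 0 by rewrite polarC.
set c := F.@[q ord0]; set B := polar F u w in Buw.
have fr : frame u q w.
  move=> x y z E0.
  have BE v x' y' z' : v = x' *: u + y' *: q + z' *: w ->
      2 * c * (y * y') + B * (x * z' + z * x') = 0.
    move=> vE; have := polarDr F v 0 0 0 0 0 0; rewrite !scale0r !addr0 !mul0r !addr0.
    rewrite polarC // -{1}E0 vE polarDD Fu Fw Buq Bqw -/c -/B => <-; ring.
  have z0 : z = 0.
    have := BE u 1 0 0; rewrite scale1r !scale0r !addr0 => /(_ erefl) /eqP.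
    by rewrite !mulr0 add0r mulr1 add0r mulf_eq0 (negPf Buw) => /eqP.
  have x0 : x = 0.
    have := BE w 0 0 1; rewrite scale1r !scale0r !add0r => /(_ erefl) /eqP.
    by rewrite !mulr0 add0r mulr1 addr0 mulf_eq0 (negPf Buw) => /eqP.
  move: E0; rewrite x0 z0 !scale0r add0r addr0 => /eqP.
  by rewrite scaler_eq0 (negPf q0) orbF => /eqP.
have comb v : exists x y z, v = x *: u + y *: q + z *: w.
  by have [X [Y [Z [_ vE]]]] := frame_coords fr; do 3!eexists; exact: vE.
have inl1 x y z : x *: u + y *: q + z *: w \in l1 <-> z = 0.
  have BE : polar F u (x *: u + y *: q + z *: w) = B * z.
    by rewrite polarDr polarvv // Fu Buq !mulr0 !add0r mulrC.
  split=> [/l1E|z0]; last by apply/l1E; rewrite BE z0 mulr0.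
  by rewrite BE => /eqP; rewrite mulf_eq0 (negPf Buw) => /eqP.
have inl3 x y z : x *: u + y *: q + z *: w \in l3 <-> x = 0.
  have BE : polar F w (x *: u + y *: q + z *: w) = B * x.
    by rewrite polarDr polarvv // Fw Bwq polarC // !mulr0 !addr0 mulrC.
  split=> [/l3E|x0]; last by apply/l3E; rewrite BE x0 mulr0.
  by rewrite BE => /eqP; rewrite mulf_eq0 (negPf Buw) => /eqP.
have polE x y z x' y' z' :
    polar F (x *: u + y *: q + z *: w) (x' *: u + y' *: q + z' *: w) =
    2 * c * (y * y') + B * (x * z' + z * x').
  by rewrite polarDD Fu Fw Buq Bqw -/c -/B; ring.
have FE x y z : F.@[(x *: u + y *: q + z *: w) ord0] = c * y ^+ 2 + B * (x * z).
  by rewrite evalD2 // Fu Fw Buq Bqw -/c -/B; ring.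
have eql1 l x : \dim l = 2%N -> (forall x' y' z',
    x' *: u + y' *: q + z' *: w \in l <-> B * (x * z') = 0) -> l = l1.
  move=> d lE; have x0 : x != 0.
    apply/eqP => x0; apply: (line_not_full d) => v.
    have [x' [y' [z' ->]]] := comb v.
    by apply/lE; rewrite x0 mul0r mulr0.
  apply/vspaceP => v; have [x' [y' [z' ->]]] := comb v.
  apply/idP/idP => [/lE|/inl1 ->]; last by apply/lE; rewrite !mulr0.
  by move/eqP; rewrite !mulf_eq0 (negPf Buw) (negPf x0) => /eqP/inl1.
have eql3 l z : \dim l = 2%N -> (forall x' y' z',
    x' *: u + y' *: q + z' *: w \in l <-> B * (z * x') = 0) -> l = l3.
  move=> d lE; have z0 : z != 0.
    apply/eqP => z0; apply: (line_not_full d) => v.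
    have [x' [y' [z' ->]]] := comb v.
    by apply/lE; rewrite z0 mul0r mulr0.
  apply/vspaceP => v; have [x' [y' [z' ->]]] := comb v.
  apply/idP/idP => [/lE|/inl3 ->]; last by apply/lE; rewrite !mulr0.
  by move/eqP; rewrite !mulf_eq0 (negPf Buw) (negPf z0) => /eqP/inl3.
(* Otherwise F would be B x z, whose only tangents are l1 and l3. *)
have c0 : c != 0.
  apply/eqP => c0; have [d4 [r Fr l4E]] := tangentP T4.
  have [x [y [z rE]]] := comb r.
  move: Fr; rewrite rE FE c0 mul0r add0r => /eqP.
  rewrite !mulf_eq0 (negPf Buw) /= => /orP[] /eqP xz0.
  - case/eqP: n43; apply: (eql3 _ z d4) => x' y' z'.
    by rewrite l4E rE polE c0 xz0 !(mulr0, mul0r, add0r).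
  - case/eqP: n41; apply: (eql1 _ x d4) => x' y' z'.
    by rewrite l4E rE polE c0 xz0 !(mulr0, mul0r, add0r, addr0).
(* This scaling of w turns F into c (y^2 - 4xz). *)
pose k := - (4 * c) / B.
have k0 : k != 0 by rewrite /k mulf_neq0 ?invr_eq0 // oppr_eq0 mulf_neq0 // pnatr_eq0.
exists u, q, (k *: w); split.
- move=> x y z; rewrite scalerA => /fr[-> -> /eqP].
  by rewrite mulf_eq0 (negPf k0) orbF => /eqP.
- move=> x y z; rewrite scalerA inl1; split=> [/eqP|->]; last by rewrite mul0r.
  by rewrite mulf_eq0 (negPf k0) orbF => /eqP.
move=> l /tangentP[d [r Fr lE]] nl1; have [x [y [z rE]]] := comb r.
move: Fr; rewrite rE FE => Fr.
have z0 : z != 0.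
  apply: contra nl1 => /eqP z0; apply/eqP; apply: (eql1 _ x d) => x' y' z'.
  move/eqP: Fr; rewrite z0 !mulr0 addr0 mulf_eq0 (negPf c0) expf_eq0 /= => /eqP y0.
  by rewrite lE rE polE y0 z0 !(mulr0, mul0r, add0r, addr0).
(* Dividing the polar of the contact point by [B * z] gives x' the coefficient 1, so t has to be
   minus the coefficient of y'. That the contact point lies on F then makes the coefficient of z'
   equal to t^2. *)
exists (- (2 * (c * y)) / (B * z)) => x' y' z'; set t := - _ / _.
have tE : B * z * t ^+ 2 = B * (x * k).
  have cyE : c * y ^+ 2 = - (B * (x * z)) by apply/eqP; rewrite -addr_eq0 Fr.
  transitivity (4 * c * (c * y ^+ 2) / (B * z)); first by rewrite /t; field; rewrite Buw z0.
  by rewrite cyE /k; field; rewrite Buw z0.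
have fE : B * z * tangent_form t x' y' z' =
    2 * c * (y * y') + B * (x * (z' * k) + z * x').
  transitivity (B * z * x' - B * z * t * y' + B * z * t ^+ 2 * z').
    by rewrite /tangent_form; ring.
  have -> : B * z * t = - (2 * (c * y)) by rewrite /t mulrC divfK ?mulf_neq0.
  by rewrite tE; ring.
split=> [/lE|fE0]; last by apply/lE; rewrite scalerA rE polE -fE fE0 mulr0.
rewrite scalerA rE polE -fE => /eqP.
by rewrite !mulf_eq0 (negPf Buw) (negPf z0) => /eqP.
Qed.
End TangentFrame.

(** * Points and their spanning vectors *)

Section Points.
Variable K : fieldType.
Implicit Types p q : point K.

Lemma vpick_point_neq0 p : vpick p != 0.
Proof. by case: p => V V1; rewrite vpick0 -dimv_eq0 /= (eqP V1). Qed.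

Lemma point_vline p : point_space p = <[vpick p]>%VS.
Proof.
apply/esym/eqP; rewrite eqEdim -memvE memv_pick dim_vline vpick_point_neq0.
by case: p => V V1 /=; rewrite (eqP V1).
Qed.

Lemma point_sub p l : (p <= l)%VS = (vpick p \in l).
Proof. by rewrite point_vline -memvE -point_vline. Qed.

Lemma point_eq p q (k : K) : vpick p = k *: vpick q -> p = q.
Proof.
move=> pq; apply: val_inj; rewrite /= [RHS]point_vline [LHS]point_vline.
have k0 : k != 0.
  by apply: contraNneq (vpick_point_neq0 p) => k0; rewrite pq k0 scale0r.
apply/eqP; rewrite eqEdim !dim_vline !vpick_point_neq0 leqnn andbT -memvE pq.
by rewrite memvZ ?memv_line.
Qed.

Lemma vline_point (v : 'rV[K]_3) : v != 0 -> \dim <[v]> == 1%N.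
Proof. by move=> v0; rewrite dim_vline v0. Qed.

Lemma line_is_line p q : p != q -> is_line (line p q).
Proof.
have d1 (r : point K) : \dim r = 1%N by case: r => V V1 /=; rewrite (eqP V1).
move=> pq; have := dimv_sum_cap p q; rewrite !d1 /is_line /line.
case dE: (\dim (p :&: q)) => [|n]; first by rewrite addn0.
case/eqP: pq; apply: val_inj => /=.
have /eqP <- : (p :&: q)%VS == p by rewrite eqEdim capvSl d1 dE.
by apply/eqP; rewrite eqEdim capvSr d1 dE.
Qed.

End Points.

(** * Finiteness of intersections and vertices in a tangent frame *)

Section Octagon.
Variable K : numFieldType.

(** A common line carries infinitely many common points, none of multiplicity 0, so all of them
    would be in [s]. This is how [intersection_is] excludes a common line. *)
Lemma finite_intersection (F G : {mpoly K[3]}) (s : seq (point K)) (v w : 'rV[K]_3) :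
  F \is 2.-homog -> G \is 2.-homog -> intersection_is F G s ->
  (forall a b : K, a *: v + b *: w = 0 -> a = 0 /\ b = 0) ->
  (forall a, F.@[(v + a *: w) ord0] = 0 /\ G.@[(v + a *: w) ord0] = 0) -> False.
Proof.
move=> F2 G2 FGs vw FG0.
have n0 a : v + a *: w != 0.
  apply/eqP => va0; have [] := vw 1 a; first by rewrite scale1r.
  by move/eqP; rewrite oner_eq0.
pose pt a : point K := Point (vline_point (n0 a)).
have pt_inj : injective pt.
  move=> a b /(congr1 (@point_space K)) /= abE.
  have /vlineP[k kE] : v + a *: w \in <[v + b *: w]>%VS by rewrite -abE memv_line.
  have [|/subr0_eq k1 /subr0_eq ->] := vw (1 - k) (a - k * b); last by rewrite -k1 mul1r.
  rewrite !scalerBl scale1r addrACA kE scalerDr scalerA -opprD subrr //.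
have ptE a : exists c, vpick (pt a) = c *: (v + a *: w).
  by apply/vlineP; apply: memv_pick.
have pts a : pt a \in s.
  rewrite -has_pred1 has_count lt0n; apply/eqP => s0.
  have := FGs (pt a); rewrite s0 => /multiplicity0; have [c cE] := ptE a.
  by apply; rewrite /on_curve /coords cE eval2Z // ?(FG0 a).1 ?(FG0 a).2 mulr0.
pose us : seq (point K) := [seq pt i%:R | i <- iota 0 (size s).+1].
have : (size us <= size s)%N.
  apply: uniq_leq_size => [|p /mapP[i _ ->] //].
  rewrite map_inj_uniq ?iota_uniq // => i j /pt_inj /eqP.
  by rewrite eqr_nat => /eqP.
by rewrite size_map size_iota ltnn.
Qed.

Variables e1 e2 e3 : 'rV[K]_3.
Hypothesis fr : frame e1 e2 e3.

Let pt x y z := x *: e1 + y *: e2 + z *: e3.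

Definition has_equation (l : {vspace 'rV[K]_3}) (f : K -> K -> K -> K) : Prop :=
  forall x y z, pt x y z \in l <-> f x y z = 0.

Lemma ptP v : exists x y z, v = pt x y z.
Proof. by have [X [Y [Z [_ vE]]]] := frame_coords fr; do 3!eexists; exact: vE. Qed.

Lemma ptZ k x y z : k *: pt x y z = pt (k * x) (k * y) (k * z).
Proof. by rewrite /pt !scalerDr !scalerA. Qed.

Lemma equation_inj l l' f : has_equation l f -> has_equation l' f -> l = l'.
Proof.
move=> lE l'E; apply/vspaceP => v; have [x [y [z ->]]] := ptP v.
by apply/idP/idP => [/lE/l'E|/l'E/lE].
Qed.

Lemma vertexE (p : point K) l l' s t : s != t ->
  has_equation l (tangent_form s) -> has_equation l' (tangent_form t) ->
  (p <= l)%VS -> (p <= l')%VS ->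
  exists2 k, k != 0 & vpick p = k *: pt (s * t) (s + t) 1.
Proof.
rewrite !point_sub -subr_eq0 => st lE l'E.
have := vpick_point_neq0 p; have [x [y [z ->]]] := ptP (vpick p).
move=> n0 /lE Es /l'E Et.
have yE : y = (s + t) * z.
  apply: (mulfI st); apply/eqP; rewrite -subr_eq0; apply/eqP.
  by rewrite -[RHS](subrr 0) -{1}Et -Es /tangent_form; ring.
have xE : x = s * t * z.
  by apply/eqP; rewrite -subr_eq0; apply/eqP; rewrite -Es yE /tangent_form; ring.
rewrite xE yE in n0 *; exists z; last by rewrite ptZ mulr1 ![z * _]mulrC.
by apply: contraNneq n0 => ->; rewrite /pt !mulr0 !scale0r !addr0.
Qed.

Lemma vertex_ooE (p : point K) l l' t :
  has_equation l (fun _ _ z => z) -> has_equation l' (tangent_form t) ->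
  (p <= l)%VS -> (p <= l')%VS ->
  exists2 k, k != 0 & vpick p = k *: pt t 1 0.
Proof.
rewrite !point_sub => lE l'E.
have := vpick_point_neq0 p; have [x [y [z ->]]] := ptP (vpick p).
move=> n0 /lE /= z0 /l'E Et.
have xE : x = t * y.
  by apply/eqP; rewrite -subr_eq0; apply/eqP; rewrite -Et z0 /tangent_form; ring.
rewrite xE z0 in n0 *; exists y; last by rewrite ptZ mulr1 mulr0 [y * _]mulrC.
by apply: contraNneq n0 => ->; rewrite /pt mulr0 !scale0r !addr0.
Qed.

Lemma frame_form a b c : exists2 M : {mpoly K[3]}, M \is 1.-homog &
  forall x y z, M.@[(pt x y z) ord0] = a * x + b * y + c * z.
Proof.
have [X [Y [Z [[X1 Y1 Z1] XYZ]]]] := frame_coords fr.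
exists (a *: X + b *: Y + c *: Z); first by rewrite !rpredD ?rpredZ.
move=> x y z; rewrite !mevalD !mevalZ.
by have [<- <- <-] := frame_inj fr (XYZ (pt x y z)).
Qed.

End Octagon.

(** * Residual points of a pencil with a degenerate member *)

Section Residual.
Variable K : numFieldType.

Lemma residual_intersection (F G M N : {mpoly K[3]}) (a b : K)
    (p q B1 B2 B : point K) (n : 'rV[K]_3) :
  F \is 2.-homog -> G \is 2.-homog -> N \is 1.-homog ->
  a *: F + b *: G = M * N -> b != 0 ->
  frame (vpick p) (vpick q) n -> N.@[n ord0] != 0 ->
  N.@[coords p] = 0 -> N.@[coords q] = 0 -> on_curve F p -> on_curve F q ->
  intersection_is F G [:: p; q; B1; B2] -> B \in [:: B1; B2] ->
  M.@[coords B] = 0.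
Proof.
move=> F2 G2 N1 FG b0 fr Nn Np Nq Fp Fq FGs Bs.
(* If p and q were conjugate, F would vanish on the whole line pq, and so would G by the pencil
   relation, as [b] is nonzero. *)
have polF : polar F (vpick p) (vpick q) != 0.
  apply/eqP => pol0; apply: (finite_intersection F2 G2 FGs (v := vpick p) (w := vpick q)).
    move=> x y xy0; have [|-> -> //] := fr x y 0.
    by rewrite scale0r addr0.
  move=> x; have F0 : F.@[(vpick p + x *: vpick q) ord0] = 0.
    have := evalD2 F2 1 x 0 (vpick p) (vpick q) 0.
    rewrite scale1r scale0r addr0 => ->.
    by rewrite Fp Fq pol0 !(mul0r, mulr0, expr0n, addr0).
  have N0 : N.@[(vpick p + x *: vpick q) ord0] = 0.
    have := evalD1 N1 1 x 0 (vpick p) (vpick q) 0.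
    by rewrite scale1r scale0r addr0 => ->; rewrite Np Nq !(mul0r, mulr0, addr0).
  split=> //; apply: (mulfI b0); rewrite mulr0 -mevalZ.
  by rewrite -[b *: G](addKr (a *: F)) FG mevalD mevalN mevalZ mevalM F0 N0 !mulr0 oppr0 addr0.
have count_gt0 : (0 < count_mem B [:: p; q; B1; B2])%N.
  by rewrite -has_count has_pred1; apply: (mem_drop (n0 := 2)).
have [FB GB] := multiplicity_on_curve count_gt0 (FGs B).
have [//|MB] := eqVneq M.@[coords B] 0; exfalso.
have NB : N.@[coords B] = 0.
  apply: (mulfI MB); rewrite mulr0 -mevalM -FG mevalD !mevalZ.
  by rewrite [X in _ * X + _]FB [X in _ + _ * X]GB !mulr0 addr0.
have [X [Y [Z [_ XYZ]]]] := frame_coords fr.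
move: (XYZ (vpick B)); set x := X.@[_]; set y := Y.@[_]; set z := Z.@[_] => BE.
have z0 : z = 0.
  move: NB; rewrite /coords BE evalD1 // Np Nq !mulr0 !add0r => /eqP.
  by rewrite mulf_eq0 (negPf Nn) orbF => /eqP.
rewrite z0 scale0r addr0 in BE.
have xy0 : x * y = 0.
  have := evalD2 F2 x y 0 (vpick p) (vpick q) 0.
  rewrite scale0r addr0 -BE [LHS]FB Fp Fq !(mul0r, mulr0, expr0n, addr0, add0r).
  by move/esym/eqP; rewrite mulf_eq0 (negPf polF) => /eqP.
have BB : (1 <= (B1 == B) + ((B2 == B) + 0))%N.
  by move: Bs; rewrite !inE ![B == _]eq_sym; do 2 case: (_ == B).
have /orP[] : (B == p) || (B == q).
- move/eqP: xy0; rewrite mulf_eq0 => /orP[] /eqP h; apply/orP.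
  + by right; apply/eqP/(point_eq (k := y)); rewrite BE h scale0r add0r.
  + by left; apply/eqP/(point_eq (k := x)); rewrite BE h scale0r addr0.
(* The list contains B once as p and again as [B1] or [B2], so its multiplicity is at least two. *)
- move=> /eqP Bp; have := FGs B; rewrite Bp in MB *.
  move=> /(transversal_multiplicity F2 N1 FG fr Nn Np Nq Fp Fq polF MB).
  rewrite leqNgt => /negP; apply; rewrite /= eqxx -Bp add1n ltnS.
  by apply: leq_trans BB (leq_addl _ _).
- have fr' : frame (vpick q) (vpick p) n.
    by move=> u v w E; have [|-> -> ->] := fr v u w; rewrite // -E [X in X + _]addrC.
  have polF' : polar F (vpick q) (vpick p) != 0 by rewrite polarC.
  move=> /eqP Bq; have := FGs B; rewrite Bq in MB *.
  move=> /(transversal_multiplicity F2 N1 FG fr' Nn Nq Np Fq Fp polF' MB).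
  rewrite leqNgt => /negP; apply; rewrite /= eqxx -Bq add1n.
  apply: leq_trans (leq_addl _ _); rewrite ltnS; exact: BB.
Qed.

End Residual.

(** * The octagon *)

(** The two points differ: equal sums and equal products would give (s - s')(s - t') = 0. The
    coefficient b is read off from the sums if they differ, and from the products otherwise. *)
Lemma chord_form_eq0 (K : fieldType) (s t s' t' x y z : K) :
  s != s' -> s != t' -> chord_form s t s' t' x y z = 0 ->
  exists a b, [/\ x = a * (s * t) + b * (s' * t'),
                  y = a * (s + t) + b * (s' + t') & z = a + b].
Proof.
move=> ss' st' E0.
have [yE|yn] := eqVneq (s' + t' - (s + t)) 0.
  have xn : s' * t' - s * t != 0.
    apply/eqP => xE; have : (s - s') * (s - t') != 0 by rewrite mulf_neq0 ?subr_eq0.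
    case/eqP; transitivity (s' * t' - s * t - s * (s' + t' - (s + t))); first by ring.
    by rewrite xE yE mulr0 subrr.
  pose b := (x - s * t * z) / (s' * t' - s * t); exists (z - b), b; split.
  - transitivity (s * t * z + b * (s' * t' - s * t)); last by ring.
    by rewrite /b divfK //; ring.
  - apply: (mulfI xn); apply/eqP; rewrite -subr_eq0; apply/eqP.
    transitivity (chord_form s t s' t' x y z
      + (s' + t' - (s + t)) * (x - s * t * z - b * (s' * t' - s * t))).
      rewrite /chord_form; ring.
    by rewrite E0 yE mul0r addr0.
  - by rewrite subrK.
pose b := (y - (s + t) * z) / (s' + t' - (s + t)); exists (z - b), b; split.
- apply: (mulfI yn); apply/eqP; rewrite -subr_eq0; apply/eqP.
  transitivity (- chord_form s t s' t' x y z
    + (s' * t' - s * t) * (y - (s + t) * z - b * (s' + t' - (s + t)))).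
    rewrite /chord_form; ring.
  by rewrite E0 /b divfK // subrr mulr0 oppr0 addr0.
- transitivity ((s + t) * z + b * (s' + t' - (s + t))); last by ring.
  by rewrite /b divfK //; ring.
- by rewrite subrK.
Qed.

Lemma circumscribed_octagon_collinear (K : numFieldType)
  (A1 A2 A3 A4 A5 A6 A7 A8 P1 P2 B1 B2 : point K)
  (gamma gamma1 gamma2 : {mpoly K[3]})
  (hP1 : point_space P1 = (line A1 A8 :&: line A2 A3)%VS)
  (hP2 : point_space P2 = (line A1 A2 :&: line A3 A4)%VS)
  (hgamma1 : conic gamma1)
  (hgamma1_thru : forall p, p \in [:: A1; A2; A5; A6; P1] -> on_curve gamma1 p)
  (hgamma2 : conic gamma2)
  (hgamma2_thru : forall p, p \in [:: A2; A3; A6; A7; P2] -> on_curve gamma2 p)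
  (hB : intersection_is gamma1 gamma2 [:: A2; A6; B1; B2])
  (hgamma : conic gamma)
  (hcirc : circumscribed
     [:: line A1 A2; line A2 A3; line A3 A4; line A4 A5;
         line A5 A6; line A6 A7; line A7 A8; line A1 A8] gamma) :
  collinear [:: A4; A8; B1; B2].
Proof.
have [_ gamma_homog] := hgamma; have [uniq_sides tan] := hcirc.
set sides := [:: _; _; _; _; _; _; _; _] in uniq_sides tan.
have neq i j : (i < 8)%N -> (j < 8)%N -> i != j -> nth 0%VS sides i != nth 0%VS sides j.
  by move=> i8 j8 ij; rewrite nth_uniq.
have tan_nth i : (i < 8)%N -> tangent gamma (nth 0%VS sides i).
  by move=> i8; apply: tan; rewrite mem_nth.
(* The sides A1A2 and A3A4 carry the frame, with A4A5 as third tangent. A1A2 becomes z = 0, of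
   parameter oo. *)
have [e1 [e2 [e3 [fr side0 side_t]]]] := tangent_frame gamma_homog
  (tan_nth 0%N isT) (tan_nth 2%N isT) (tan_nth 3%N isT)
  (neq 0%N 2%N isT isT isT) (neq 3%N 0%N isT isT isT) (neq 3%N 2%N isT isT isT).
have param i : (0 < i < 8)%N ->
    exists t, has_equation e1 e2 e3 (nth 0%VS sides i) (tangent_form t).
  by move=> /andP[i0 i8]; apply: side_t; [exact: tan_nth | apply: neq => //; case: i i0 i8].
have dist i j s t : (i < 8)%N -> (j < 8)%N -> i != j ->
    has_equation e1 e2 e3 (nth 0%VS sides i) (tangent_form s) ->
    has_equation e1 e2 e3 (nth 0%VS sides j) (tangent_form t) -> s != t.
  move=> i8 j8 ij iE jE; apply: contraNneq (neq i j i8 j8 ij) => st.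
  by rewrite st in iE; apply/eqP/(equation_inj fr iE jE).
have [t2 E2] := param 1%N isT; have [t3 E3] := param 2%N isT.
have [t4 E4] := param 3%N isT; have [t5 E5] := param 4%N isT.
have [t6 E6] := param 5%N isT; have [t7 E7] := param 6%N isT.
have [t8 E8] := param 7%N isT.
have n23 : t2 != t3 by exact: (dist _ _ _ _ _ _ _ E2 E3).
have n34 : t3 != t4 by exact: (dist _ _ _ _ _ _ _ E3 E4).
have n45 : t4 != t5 by exact: (dist _ _ _ _ _ _ _ E4 E5).
have n56 : t5 != t6 by exact: (dist _ _ _ _ _ _ _ E5 E6).
have n67 : t6 != t7 by exact: (dist _ _ _ _ _ _ _ E6 E7).
have n78 : t7 != t8 by exact: (dist _ _ _ _ _ _ _ E7 E8).
have n82 : t8 != t2 by exact: (dist _ _ _ _ _ _ _ E8 E2).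
have n52 : t5 != t2 by exact: (dist _ _ _ _ _ _ _ E5 E2).
have n58 : t5 != t8 by exact: (dist _ _ _ _ _ _ _ E5 E8).
have n64 : t6 != t4 by exact: (dist _ _ _ _ _ _ _ E6 E4).
have n32 : t3 != t2 by exact: (dist _ _ _ _ _ _ _ E3 E2).
have n62 : t6 != t2 by exact: (dist _ _ _ _ _ _ _ E6 E2).
have n63 : t6 != t3 by exact: (dist _ _ _ _ _ _ _ E6 E3).
have n75 : t7 != t5 by exact: (dist _ _ _ _ _ _ _ E7 E5).
have n37 : t3 != t7 by exact: (dist _ _ _ _ _ _ _ E3 E7).
have n38 : t3 != t8 by exact: (dist _ _ _ _ _ _ _ E3 E8).
have n48 : t4 != t8 by exact: (dist _ _ _ _ _ _ _ E4 E8).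
have L (p q : point K) : (p <= line p q)%VS by exact: addvSl.
have Rr (p q : point K) : (q <= line p q)%VS by exact: addvSr.
have P1l : (P1 <= line A1 A8)%VS && (P1 <= line A2 A3)%VS by rewrite hP1 capvSl capvSr.
have P2l : (P2 <= line A1 A2)%VS && (P2 <= line A3 A4)%VS by rewrite hP2 capvSl capvSr.
have [/andP[P1a P1b] /andP[P2a P2b]] := (P1l, P2l).
have [a1 a1n A1E] := vertex_ooE fr side0 E8 (L _ _) (L _ _).
have [a2 a2n A2E] := vertex_ooE fr side0 E2 (Rr _ _) (L _ _).
have [b2 b2n P2E] := vertex_ooE fr side0 E3 P2a P2b.
have [b1 b1n P1E] := vertexE fr n82 E8 E2 P1a P1b.
have [a3 a3n A3E] := vertexE fr n23 E2 E3 (Rr _ _) (L _ _).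
have [a4 a4n A4E] := vertexE fr n34 E3 E4 (Rr _ _) (L _ _).
have [a5 a5n A5E] := vertexE fr n45 E4 E5 (Rr _ _) (L _ _).
have [a6 a6n A6E] := vertexE fr n56 E5 E6 (Rr _ _) (L _ _).
have [a7 a7n A7E] := vertexE fr n67 E6 E7 (Rr _ _) (L _ _).
have [a8 a8n A8E] := vertexE fr n78 E7 E8 (Rr _ _) (Rr _ _).
pose pt x y z := x *: e1 + y *: e2 + z *: e3.
pose ev (G : {mpoly K[3]}) x y z := G.@[(pt x y z) ord0].
have ev0 (G : {mpoly K[3]}) (p : point K) (k x y z : K) : conic G -> k != 0 -> vpick p = k *: pt x y z ->
    on_curve G p -> ev G x y z = 0.
  move=> [_ G2] k0; rewrite /on_curve /coords => ->; rewrite eval2Z // => /eqP.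
  by rewrite mulf_eq0 expf_eq0 (negPf k0) => /eqP.
have nonzero (G : {mpoly K[3]}) (u w p q r k : K) : conic G ->
    (forall x y z, ev G x y z = k * pencil_conic u w p q r x y z) -> k != 0.
  move=> [/eqP G0 G2] GE; apply/eqP => k0; apply: G0; apply: quadratic_eq0 => // v.
  have [x [y [z ->]]] := ptP fr v; rewrite -/(ev G x y z) GE k0 mul0r.
  by [].
have [on1_A1 on1_A2 on1_A5 on1_A6 on1_P1] : [/\ on_curve gamma1 A1,
    on_curve gamma1 A2, on_curve gamma1 A5, on_curve gamma1 A6 & on_curve gamma1 P1].
  have on1 i : (i < 5)%N -> on_curve gamma1 (nth A1 [:: A1; A2; A5; A6; P1] i).
    by move=> i5; apply: hgamma1_thru; rewrite mem_nth.
  by split; [exact: (on1 0%N isT) | exact: (on1 1%N isT) | exact: (on1 2%N isT)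
    | exact: (on1 3%N isT) | exact: (on1 4%N isT)].
have [on2_A2 on2_A3 on2_A6 on2_A7 on2_P2] : [/\ on_curve gamma2 A2,
    on_curve gamma2 A3, on_curve gamma2 A6, on_curve gamma2 A7 & on_curve gamma2 P2].
  have on2 i : (i < 5)%N -> on_curve gamma2 (nth A1 [:: A2; A3; A6; A7; P2] i).
    by move=> i5; apply: hgamma2_thru; rewrite mem_nth.
  by split; [exact: (on2 0%N isT) | exact: (on2 1%N isT) | exact: (on2 2%N isT)
    | exact: (on2 3%N isT) | exact: (on2 4%N isT)].
(* With u = t2 and w = t8, the five points are A2, A1, P1, A5 and A6, in the order of
   [pencil_conic_uniq]. *)
have [k1 G1E] : exists k, forall x y z,
    ev gamma1 x y z = k * pencil_conic t2 t8 t4 t5 t6 x y z.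
  apply: (pencil_conic_uniq (fun x y z => evalD2 hgamma1.2 x y z e1 e2 e3)) => //.
  - exact: (ev0 _ _ _ _ _ _ hgamma1 a2n A2E on1_A2).
  - exact: (ev0 _ _ _ _ _ _ hgamma1 a1n A1E on1_A1).
  - rewrite [t2 * t8]mulrC [t2 + t8]addrC.
    exact: (ev0 _ _ _ _ _ _ hgamma1 b1n P1E on1_P1).
  - exact: (ev0 _ _ _ _ _ _ hgamma1 a5n A5E on1_A5).
  - exact: (ev0 _ _ _ _ _ _ hgamma1 a6n A6E on1_A6).
(* With u = t2 and w = t3, they are A2, P2, A3, A6 and A7. *)
have [k2 G2E] : exists k, forall x y z,
    ev gamma2 x y z = k * pencil_conic t2 t3 t5 t6 t7 x y z.
  apply: (pencil_conic_uniq (fun x y z => evalD2 hgamma2.2 x y z e1 e2 e3)) => //.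
  - exact: (ev0 _ _ _ _ _ _ hgamma2 a2n A2E on2_A2).
  - exact: (ev0 _ _ _ _ _ _ hgamma2 b2n P2E on2_P2).
  - exact: (ev0 _ _ _ _ _ _ hgamma2 a3n A3E on2_A3).
  - exact: (ev0 _ _ _ _ _ _ hgamma2 a6n A6E on2_A6).
  - exact: (ev0 _ _ _ _ _ _ hgamma2 a7n A7E on2_A7).
have k1n := nonzero _ _ _ _ _ _ _ hgamma1 G1E.
have k2n := nonzero _ _ _ _ _ _ _ hgamma2 G2E.
pose c := (t8 - t2) * (t3 - t2).
have c0 : c != 0 by rewrite mulf_neq0 // subr_eq0.
(* [M] is the line A4A8, scaled by the constant [c] of [pencil_conic_eq], and [N] is the line
   A2A6. *)
have [M M1 ME] := frame_form fr (c * (t3 + t4 - (t7 + t8))) (- (c * (t3 * t4 - t7 * t8)))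
  (c * (t3 * t4 * (t7 + t8) - t7 * t8 * (t3 + t4))).
have [N N1 NE] := frame_form fr 1 (- t2) (t2 * (t5 + t6) - t5 * t6).
have {}ME x y z : ev M x y z = c * chord_form t3 t4 t7 t8 x y z.
  by rewrite /ev ME /chord_form; ring.
have {}NE x y z : ev N x y z = chord_form_oo t2 t5 t6 x y z.
  by rewrite /ev NE /chord_form_oo; ring.
have pencilE : ((t3 - t2) * (t3 - t7) / k1) *: gamma1
    + ((t8 - t2) * (t4 - t8) / k2) *: gamma2 = M * N.
  apply: quadratic_ext; first by rewrite rpredD ?rpredZ ?hgamma1.2 ?hgamma2.2.
    exact: (dhomogM M1 N1).
  move=> v; have [x [y [z ->]]] := ptP fr v.
  rewrite mevalD !mevalZ mevalM -/(pt x y z) -!/(ev _ x y z) G1E G2E ME NE.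
  by rewrite -[RHS]mulrA -pencil_conic_eq !mulrA !divfK.
have onM (B : point K) : B \in [:: B1; B2] -> M.@[coords B] = 0.
  (* [e1] is on A1A2 but not on A2A6: [N] takes the value 1 there. *)
  apply: (residual_intersection (n := e1) hgamma1.2 hgamma2.2 N1 pencilE _ _ _ _ _ _ _ hB).
  - by rewrite mulf_neq0 ?invr_eq0 // mulf_neq0 // subr_eq0.
  - move=> x y z; rewrite A2E A6E.
    have -> : x *: (a2 *: pt t2 1 0) + y *: (a6 *: pt (t5 * t6) (t5 + t6) 1) + z *: e1 =
      pt (x * a2 * t2 + y * a6 * (t5 * t6) + z) (x * a2 + y * a6 * (t5 + t6)) (y * a6).
      by apply/rowP => i; rewrite !mxE; ring.
    move=> /fr[X0 Y0 Z0].
    have y0 : y = 0 by apply/eqP; move/eqP: Z0; rewrite mulf_eq0 (negPf a6n) orbF.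
    have x0 : x = 0.
      move: Y0; rewrite y0 !mul0r addr0 => /eqP.
      by rewrite mulf_eq0 (negPf a2n) orbF => /eqP.
    by move: X0; rewrite x0 y0 !mul0r !add0r.
  - have -> : e1 = pt 1 0 0 by rewrite /pt !scale0r !addr0 scale1r.
    rewrite -/(ev N 1 0 0) NE /chord_form_oo !mulr0 subr0 addr0; exact: oner_neq0.
  - rewrite /coords A2E -/(pt t2 1 0); have := evalD1 N1 a2 0 0 (pt t2 1 0) 0 0.
    rewrite !scale0r !addr0 => ->; rewrite -/(ev N t2 1 0) NE /chord_form_oo.
    by ring.
  - rewrite /coords A6E -/(pt (t5 * t6) (t5 + t6) 1); have := evalD1 N1 a6 0 0 (pt (t5 * t6) (t5 + t6) 1) 0 0.
    rewrite !scale0r !addr0 => ->.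
    rewrite -/(ev N (t5 * t6) (t5 + t6) 1) NE /chord_form_oo.
    by ring.
  - exact: on1_A2.
  - exact: on1_A6.
(* Otherwise A4 would lie on A7A8, but the tangent form of t7 at {t3, t4} is (t3 - t7)(t4 - t7). *)
have A48 : A4 != A8.
  apply/eqP => A48; have : vpick A4 \in line A7 A8 by rewrite -point_sub A48; exact: Rr.
  rewrite A4E -[_ *: _]/(_ *: pt _ _ _) ptZ => /E7 /eqP; apply/negP.
  have -> : tangent_form t7 (a4 * (t3 * t4)) (a4 * (t3 + t4)) (a4 * 1) =
    a4 * (t3 - t7) * (t4 - t7) by rewrite /tangent_form; ring.
  by rewrite !mulf_neq0 // subr_eq0 // (dist _ _ _ _ _ _ _ E4 E7).
exists (line A4 A8); split; first exact: line_is_line.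
have onL (B : point K) : B \in [:: B1; B2] -> (B <= line A4 A8)%VS.
  move=> /onM; rewrite point_sub /coords; have [x [y [z ->]]] := ptP fr (vpick B).
  rewrite -/(pt x y z) -/(ev M x y z) ME => /eqP; rewrite mulf_eq0 (negPf c0) => /eqP.
  move=> /(chord_form_eq0 n37 n38)[a [b [-> -> ->]]].
  have -> : pt (a * (t3 * t4) + b * (t7 * t8)) (a * (t3 + t4) + b * (t7 + t8)) (a + b)
      = (a / a4) *: vpick A4 + (b / a8) *: vpick A8.
    rewrite A4E A8E !scalerA !divfK // /pt; apply/rowP => i; rewrite !mxE; ring.
  by apply: memv_add; apply: memvZ; apply: memv_pick.
move=> p; rewrite !inE => /or4P[] /eqP ->; rewrite ?L ?Rr //; apply: onL;
  by rewrite !inE eqxx ?orbT.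
Qed.

Local Open Scope complex_scope.

Theorem proposition5p1 (R : realType)
  (A1 A2 A3 A4 A5 A6 A7 A8 P1 P2 B1 B2 : point R[i])
  (gamma gamma1 gamma2 : {mpoly R[i][3]})
  (hP1 : point_space P1 = (line A1 A8 :&: line A2 A3)%VS)
  (hP2 : point_space P2 = (line A1 A2 :&: line A3 A4)%VS)
  (hgamma1 : conic gamma1)
  (hgamma1_thru : forall p, p \in [:: A1; A2; A5; A6; P1] -> on_curve gamma1 p)
  (hgamma2 : conic gamma2)
  (hgamma2_thru : forall p, p \in [:: A2; A3; A6; A7; P2] -> on_curve gamma2 p)
  (hB : intersection_is gamma1 gamma2 [:: A2; A6; B1; B2])
  (hgamma : conic gamma)
  (hgamma_irr : irreducible_curve gamma)
  (hcirc : circumscribed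
     [:: line A1 A2; line A2 A3; line A3 A4; line A4 A5;
         line A5 A6; line A6 A7; line A7 A8; line A1 A8] gamma) :
  collinear [:: A4; A8; B1; B2].
Proof.
exact: (circumscribed_octagon_collinear hP1 hP2 hgamma1 hgamma1_thru hgamma2
  hgamma2_thru hB hgamma hcirc).
Qed.
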